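(* Let the weight $w$ on $\mathbb N_0$ satisfy the discrete Pearson equation $\theta(k+1)w(k+1)=\sigma(k)w(k)$, $k\in\mathbb N_0$, with $\theta,\sigma$ polynomials and $\theta(0)=0$. Then the following compatibility conditions for the Laguerre--Freud structure matrix $\Psi=\Pi^{-1}H\theta(J^\top)=\sigma(J)H\Pi^\top$ and the Jacobi matrix $J$ hold: $$[\Psi H^{-1},J]=\Psi H^{-1},\qquad [J,\Psi^\top H^{-1}]=\Psi^\top H^{-1}.$$
   Context: $\mathbb N_0=\{0,1,2,\dots\}$; all matrices are semi-infinite, indexed by $\mathbb N_0$; $[A,C]=AC-CA$. The moments $\rho_n=\sum_{k=0}^\infty k^nw(k)$ are assumed (absolutely) convergent, and all leading principal minors of the moment matrix $G=(\rho_{n+m})_{n,m\in\mathbb N_0}$ are assumed nonzero, so that $G=S^{-1}HS^{-\top}$ uniquely with $S$ lower unitriangular and $H=\operatorname{diag}(H_0,H_1,\dots)$, $H_n\neq0$. $\Lambda$ is the shift matrix with ones on the first superdiagonal and zeros elsewhere; $J=S\Lambda S^{-1}$ is the Jacobi matrix (tridiagonal). $B$ is the lower Pascal matrix, $B_{n,m}=\binom nm$ for $n\ge m$, $0$ otherwise, and $\Pi=SBS^{-1}$. The two expressions for $\Psi$ coincide and $\Psi$ is banded. *)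

(* Defs.v *)
From HB Require Import structures.
From mathcomp Require Import all_boot all_order all_algebra.
From mathcomp Require Import all_classical all_reals all_analysis.

Set Implicit Arguments.
Unset Strict Implicit.
Unset Printing Implicit Defensive.

Import Order.TTheory GRing.Theory Num.Theory.
Import numFieldNormedType.Exports.

Local Open Scope classical_set_scope.
Local Open Scope ring_scope.

(* MathComp-Analysis. The scalars form an arbitrary [numFieldType] [K] with the
   topology of its norm, e.g. [R] or [R[i]] for [R : realType]. *)

Definition smx (K : Type) := nat -> nat -> K.

Section SemiInfiniteMatrices.
Variable K : numFieldType.
Implicit Types A C : smx K.

(* [\sum_(k \in setT)] is the sum of a finitely supported family. All the
   products in use below have rows of the left factor, or columns of the right
   factor, with finitely many nonzero entries, so that each entry of the product
   is such a sum (in other cases the default value 0 is returned). *)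
Definition smul A C : smx K :=
  fun n m => \sum_(k \in [set: nat]) (A n k * C k m).

Definition sdiag (h : nat -> K) : smx K :=
  fun n m => if n == m then h n else 0.

Definition sone : smx K := sdiag (fun=> 1).

Definition str A : smx K := fun n m => A m n.

Definition scomm A C : smx K := fun n m => smul A C n m - smul C A n m.

Definition spow A (i : nat) : smx K := iter i (smul A) sone.

Definition spoly (p : {poly K}) A : smx K :=
  fun n m => \sum_(i < size p) p`_i * spow A i n m.

Definition slower A : Prop := forall n m, (n < m)%N -> A n m = 0.

Definition sunitri A : Prop := slower A /\ forall n, A n n = 1.

(* A semi-infinite matrix may have several two-sided inverses; the inverse of a
   lower triangular one is taken among the lower triangular matrices, where it
   is unique. Existence is [slinvP] below. *)
Definition slinv A : smx K :=
  get [set C : smx K | [/\ slower C, smul A C = sone & smul C A = sone]].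

Definition shift : smx K := fun n m => if m == n.+1 then 1 else 0.

(* ['C(n, m)] vanishes for [n < m]. *)
Definition pascal : smx K := fun n m => 'C(n, m)%:R.

End SemiInfiniteMatrices.

Arguments sone {K}.
Arguments shift {K}.
Arguments pascal {K}.

Declare Scope smx_scope.
Delimit Scope smx_scope with smx.
Infix "*oo" := smul (at level 40, left associativity) : smx_scope.
Local Open Scope smx_scope.

Section DiscreteOrthogonality.
Variable K : numFieldType.
Implicit Types (w h : nat -> K) (S : smx K).

Definition moment_terms w (n : nat) : nat -> K := fun k => k%:R ^+ n * w k.

(* Plain convergence, which absolute convergence implies over the real and the
   complex numbers. *)
Definition moments_cvg w : Prop := forall n, cvgn (series (moment_terms w n)).

Definition moment w (n : nat) : K := limn (series (moment_terms w n)).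

Definition moment_mx w : smx K := fun n m => moment w (n + m).

Definition leading_minors_neq0 (G : smx K) : Prop :=
  forall n, \det (\matrix_(i < n.+1, j < n.+1) G i j) != 0.

(* The Cholesky (Gauss--Borel) factorization G = S^-1 H S^-T, H = diag(h). *)
Definition cholesky (G : smx K) S h : Prop :=
  [/\ sunitri S, forall n, h n != 0
    & G = slinv S *oo sdiag h *oo str (slinv S)].

Definition jacobi S : smx K := S *oo shift *oo slinv S.

Definition dressed_pascal S : smx K := S *oo pascal *oo slinv S.

Definition pearson w (theta sigma : {poly K}) : Prop :=
  forall k : nat, theta.[k.+1%:R] * w k.+1 = sigma.[k%:R] * w k.

End DiscreteOrthogonality.

Section LowerInverse.
Variable K : numFieldType.
Implicit Types A C : smx K.

Lemma smul_lowerE A C n m N : slower A -> (n < N)%N ->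
  smul A C n m = \sum_(k < N) A n k * C k m.
Proof.
move=> lA nN; rewrite (fsbig_ord _ _ (fun k => A n k * C k m)) /smul.
apply/esym/fsbig_widen => // k [_ /= kN].
by rewrite lA ?mul0r // (leq_trans nN) // leqNgt; apply/negP.
Qed.

Lemma smulA_lower A C (D : smx K) : slower A -> slower C ->
  smul A (smul C D) = smul (smul A C) D.
Proof.
move=> lA lC; apply/funext => n; apply/funext => m.
have lAC : slower (smul A C).
  move=> i j ij; rewrite (smul_lowerE _ _ lA (ltnSn i)) big1 // => k _.
  by rewrite lC ?mulr0 // (leq_ltn_trans _ ij) // -ltnS.
rewrite (smul_lowerE _ _ lA (ltnSn n)) (smul_lowerE _ _ lAC (ltnSn n)).
under eq_bigr => k _ do rewrite (smul_lowerE _ _ lC (ltn_ord k)) mulr_sumr.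
under [RHS]eq_bigr => k _ do
  rewrite (smul_lowerE _ _ lA (ltnSn n)) mulr_suml.
rewrite exchange_big; apply: eq_bigr => j _; apply: eq_bigr => k _.
by rewrite mulrA.
Qed.

Lemma soneE n m : (sone : smx K) n m = (n == m)%:R.
Proof. by rewrite /sone /sdiag; case: eqP. Qed.

Lemma slower_sone : slower (sone : smx K).
Proof. by move=> n m nm; rewrite soneE; move: nm; case: ltngtP. Qed.

Lemma smulr1 A : slower A -> smul A sone = A.
Proof.
move=> lA; apply/funext => n; apply/funext => m.
have nN : (n < (maxn n m).+1)%N by rewrite ltnS leq_maxl.
have mN : (m < (maxn n m).+1)%N by rewrite ltnS leq_maxr.
rewrite (smul_lowerE _ _ lA nN) (bigD1 (Ordinal mN)) //= soneE eqxx mulr1.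
rewrite big1 ?addr0 // => k /negPf km; rewrite soneE.
by rewrite (_ : (k == m :> nat) = false) ?mulr0.
Qed.

Lemma smul1r A : smul sone A = A.
Proof.
apply/funext => n; apply/funext => m.
rewrite (smul_lowerE _ _ slower_sone (ltnSn n)) big_ord_recr /= soneE eqxx.
rewrite mul1r big1 ?add0r // => k _; rewrite soneE gtn_eqF ?mul0r //.
Qed.

Lemma lower_right_inverse A : slower A -> (forall n, A n n != 0) ->
  exists C, [/\ slower C, (forall n, C n n != 0) & smul A C = sone].
Proof.
move=> lA dA.
pose F := fix F n : smx K := if n is n'.+1 then
  fun i m => if i == n' then
     (sone n' m - \sum_(k < n') A n' k * F n' k m) / A n' n' else F n' i m
  else fun _ _ => 0.
pose C : smx K := fun i m => F i.+1 i m.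
have FC n i m : (i < n)%N -> F n i m = C i m.
  elim: n => // n IH; rewrite ltnS leq_eqVlt => /predU1P[-> //|lin].
  by rewrite /= ifN ?IH // neq_ltn lin.
have CE n m : C n m = (sone n m - \sum_(k < n) A n k * C k m) / A n n.
  rewrite {1}/C /= eqxx; congr ((_ - _) / _).
  by apply: eq_bigr => k _; rewrite FC.
have lC : slower C.
  elim/ltn_ind => n IH m nm; rewrite CE slower_sone //.
  by rewrite big1 ?subr0 ?mul0r // => k _; rewrite IH ?mulr0 ?(ltn_trans _ nm).
exists C; split=> //.
  move=> n; rewrite CE soneE eqxx big1 => [|k _].
    by rewrite subr0 mul1r invr_neq0.
  by rewrite lC ?mulr0.
apply/funext => n; apply/funext => m.
rewrite (smul_lowerE _ _ lA (ltnSn n)) big_ord_recr /= [C n m]CE.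
by rewrite mulrC divfK // addrC subrK.
Qed.

Lemma slinvP A : slower A -> (forall n, A n n != 0) ->
  [/\ slower (slinv A), smul A (slinv A) = sone & smul (slinv A) A = sone].
Proof.
move=> lA dA.
have [C [lC dC AC]] := lower_right_inverse lA dA.
have [D [lD dD CD]] := lower_right_inverse lC dC.
have AD : A = D by rewrite -[LHS]smulr1 // -CD smulA_lower // AC smul1r.
apply: (@getI _ [set C : smx K |
  [/\ slower C, smul A C = sone & smul C A = sone]] C).
by split=> //; rewrite {1}AD.
Qed.

Lemma slinv_uniq A C : slower A -> (forall n, A n n != 0) ->
  slower C -> smul A C = sone -> slinv A = C.
Proof.
move=> lA dA lC AC; have [lI _ IA] := slinvP lA dA.
by rewrite -[LHS]smulr1 // -AC smulA_lower // IA smul1r.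
Qed.

End LowerInverse.

(* Main.v *)
(* Write G for the moment matrix, L for the shift and B for the Pascal matrix.
   Since S G S^T = H, conjugation gives p(J) H = S (p(L) G) S^T for each
   polynomial p. The entries of p(L) G are the moments of p x^(n+m), hence
   p(J) H is symmetric, and H theta(J^T) = theta(J) H. Summing the Pearson
   equation against (k+1)^(n+m) gives theta(L) G = B sigma(L) G B^T, which
   dresses to theta(J) H = Pi sigma(J) H Pi^T, the equality of the two
   expressions of Psi. Then Psi H^-1 = Pi^-1 theta(J) and
   Psi^T H^-1 = Pi sigma(J), while Pascal's rule [L, B] = B dresses to
   [J, Pi] = Pi, equivalently [Pi^-1, J] = Pi^-1.
   G and Pi^T are not row-finite, so associativity of the products is justified
   by row- or column-finiteness of two of the three factors. *)
Require Import Defs.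
From mathcomp Require Import all_boot all_order all_algebra.
From mathcomp Require Import all_classical all_reals all_analysis.
Import Order.TTheory GRing.Theory Num.Theory.
Import numFieldNormedType.Exports.
Local Open Scope ring_scope.
Local Open Scope smx_scope.

Set Implicit Arguments.
Unset Strict Implicit.
Unset Printing Implicit Defensive.

Local Notation shift := Defs.shift.

(** * Products of row-finite matrices: associativity, commutators, polynomials *)

Section RowFinite.
Context {K : numFieldType}.
Implicit Types A C D : smx K.

Definition rowfin A := forall n, exists N, forall k, (N <= k)%N -> A n k = 0.

(** [scomm] is convertible to an [ssub] of two products, so distributivity applies to it once it is
    stated for [ssub]. *)
Definition ssub A C : smx K := fun n m => A n m - C n m.

Lemma smx_ext A C : (forall n m, A n m = C n m) -> A = C.
Proof. by move=> AC; apply/funext => n; apply/funext => m. Qed.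

Lemma smulE N A C n m :
  (forall k, (N <= k)%N -> A n k = 0) ->
  (A *oo C) n m = \sum_(k < N) A n k * C k m.
Proof.
move=> A0; rewrite (fsbig_ord _ _ (fun k => A n k * C k m)) /smul.
apply/esym/fsbig_widen => // k [_ /= kN].
by rewrite A0 ?mul0r // leqNgt; apply/negP.
Qed.

(** No finiteness is assumed: both entries sum the same family over [k], so even the default value
    agrees. *)
Lemma str_smul A C : str (A *oo C) = str C *oo str A.
Proof.
by apply: smx_ext => n m; apply: eq_fsbigr => k _; rewrite mulrC.
Qed.

Lemma rowfin_slower A : slower A -> rowfin A.
Proof. by move=> lA n; exists n.+1 => k; apply: lA. Qed.

Lemma slower_sdiag (h : nat -> K) : slower (sdiag h).
Proof. by move=> n m nm; rewrite /sdiag ltn_eqF. Qed.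

Lemma rowfin_sdiag (h : nat -> K) : rowfin (sdiag h).
Proof. exact: rowfin_slower (@slower_sdiag h). Qed.

Lemma str_sdiag (h : nat -> K) : str (sdiag h) = sdiag h.
Proof.
by apply: smx_ext => n m; rewrite /str /sdiag eq_sym; case: eqP => // ->.
Qed.

Lemma rowfin_shift : rowfin (shift : smx K).
Proof. by move=> n; exists n.+2 => k nk; rewrite /Defs.shift gtn_eqF. Qed.

Lemma slower_pascal : slower (pascal : smx K).
Proof. by move=> n m nm; rewrite /pascal bin_small. Qed.

Lemma rowfin_smul A C : rowfin A -> rowfin C -> rowfin (A *oo C).
Proof.
move=> fA fC n; have [N An0] := fA n.
have [M MP] := choice fC.
exists (\max_(i < N) M i)%N => m Mm; rewrite (@smulE N) // big1 // => k _.
rewrite MP ?mulr0 //; apply: leq_trans Mm.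
exact: (leq_bigmax_cond (F := fun i : 'I_N => M i)).
Qed.

Lemma rowfin_spow A i : rowfin A -> rowfin (spow A i).
Proof.
move=> fA; elim: i => [|i IH]; first exact: rowfin_sdiag.
exact: rowfin_smul.
Qed.

Lemma rowfin_spoly p A : rowfin A -> rowfin (spoly p A).
Proof.
move=> fA n; have [M MP] := choice (fun i => @rowfin_spow A i fA n).
exists (\max_(i < size p) M i)%N => m Mm; rewrite /spoly big1 // => i _.
rewrite MP ?mulr0 //; apply: leq_trans Mm.
exact: (leq_bigmax_cond (F := fun i : 'I_(size p) => M i)).
Qed.

(** Row [n] of [A] selects finitely many rows of [C], each with finite support, so the double sum is
    finite for arbitrary [D]. *)
Lemma smulA A C D : rowfin A -> rowfin C -> A *oo (C *oo D) = A *oo C *oo D.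
Proof.
move=> fA fC; apply: smx_ext => n m.
have [N An0] := fA n; have [M MP] := choice fC.
have [L AC0] := rowfin_smul fA fC n.
(* [P] bounds row [n] of the product and all the rows of [C] involved, giving both expansions a
   common range. *)
pose P := maxn L (\max_(i < N) M i)%N.
rewrite (@smulE N) // (@smulE P); last first.
  by move=> k; rewrite geq_max => /andP[Lk _]; apply: AC0.
under [RHS]eq_bigr => k _ do rewrite (@smulE N) // mulr_suml.
rewrite [RHS]exchange_big; apply: eq_bigr => j _ /=.
rewrite (@smulE P) ?mulr_sumr; first by apply: eq_bigr => k _; rewrite mulrA.
move=> k; rewrite geq_max => /andP[_ Mk]; apply: MP; apply: leq_trans Mk.
exact: (leq_bigmax_cond (F := fun i : 'I_N => M i)).
Qed.

(** The outer factors bound both summation indices, so the middle one may be arbitrary, such as the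
    moment matrix. *)
Lemma smulA_col A C D : rowfin A -> rowfin (str D) ->
  A *oo (C *oo D) = A *oo C *oo D.
Proof.
move=> fA fD; apply: smx_ext => n m.
have [N An0] := fA n; have [M DM] := fD m.
have right E k : (E *oo D) k m = \sum_(j < M) E k j * D j m.
  have -> : (E *oo D) k m = str (E *oo D) m k by [].
  rewrite str_smul (@smulE M) //; apply: eq_bigr => j _.
  by rewrite /str mulrC.
rewrite (@smulE N) // right.
under eq_bigr => k _ do rewrite right mulr_sumr.
under [RHS]eq_bigr => k _ do rewrite (@smulE N) // mulr_suml.
rewrite exchange_big; apply: eq_bigr => j _; apply: eq_bigr => k _.
by rewrite mulrA.
Qed.

Lemma smulA_cols A C D : rowfin (str C) -> rowfin (str D) ->
  A *oo (C *oo D) = A *oo C *oo D.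
Proof.
move=> fC fD; rewrite -[LHS]/(str (str _)) -[RHS]/(str (str _)).
by congr str; rewrite !str_smul smulA.
Qed.

Lemma smulBr A C D : rowfin A -> A *oo ssub C D = ssub (A *oo C) (A *oo D).
Proof.
move=> fA; apply: smx_ext => n m; have [N An0] := fA n.
rewrite /ssub !(@smulE N) // -sumrB; apply: eq_bigr => k _.
by rewrite mulrBr.
Qed.

Lemma smulBl A C D : rowfin A -> rowfin C ->
  ssub A C *oo D = ssub (A *oo D) (C *oo D).
Proof.
move=> fA fC; apply: smx_ext => n m.
have [N An0] := fA n; have [M Cn0] := fC n.
have An k : (maxn N M <= k)%N -> A n k = 0.
  by rewrite geq_max => /andP[/An0].
have Cn k : (maxn N M <= k)%N -> C n k = 0.
  by rewrite geq_max => /andP[_ /Cn0].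
rewrite /ssub !(@smulE (maxn N M)) //; last first.
  by move=> k Nk; rewrite An ?Cn ?subrr.
by rewrite -sumrB; apply: eq_bigr => k _; rewrite mulrBl.
Qed.

Lemma smulr1_rowfin A : rowfin A -> A *oo sone = A.
Proof.
move=> fA; apply: smx_ext => n m; have [N An0] := fA n.
rewrite (@smulE (maxn N m.+1)); last first.
  by move=> k; rewrite geq_max => /andP[/An0].
have mN : (m < maxn N m.+1)%N by rewrite leq_maxr.
rewrite (bigD1 (Ordinal mN)) //= soneE eqxx mulr1 big1 ?addr0 // => k.
by rewrite -val_eqE /= soneE => /negPf->; rewrite mulr0.
Qed.

Lemma smul_spolyr A p C n m : rowfin A ->
  (A *oo spoly p C) n m = \sum_(i < size p) p`_i * (A *oo spow C i) n m.
Proof.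
move=> fA; have [N An0] := fA n; rewrite (@smulE N) //.
under eq_bigr => k _ do rewrite /spoly mulr_sumr.
rewrite exchange_big; apply: eq_bigr => i _ /=.
by rewrite (@smulE N) // mulr_sumr; apply: eq_bigr => k _; rewrite mulrCA.
Qed.

Lemma smul_spolyl p A C n m : rowfin A ->
  (spoly p A *oo C) n m = \sum_(i < size p) p`_i * (spow A i *oo C) n m.
Proof.
move=> fA; have [M MP] := choice (fun i => @rowfin_spow A i fA n).
pose N := (\max_(i < size p) M i)%N.
have PN (i : 'I_(size p)) k : (N <= k)%N -> spow A i n k = 0.
  move=> Nk; apply: MP; apply: leq_trans Nk.
  exact: (leq_bigmax_cond (F := fun i : 'I_(size p) => M i)).
rewrite (@smulE N); last first.
  by move=> k Nk; rewrite /spoly big1 // => i _; rewrite PN ?mulr0.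
under eq_bigr => k _ do rewrite /spoly mulr_suml.
rewrite exchange_big; apply: eq_bigr => i _ /=.
rewrite (@smulE N) ?mulr_sumr; last by move=> k; apply: PN.
by apply: eq_bigr => k _; rewrite mulrA.
Qed.

(** The relation passes to powers by induction, then to linear combinations. It serves for
    conjugation by [S], for moving [H] past polynomials, and for commutation of [J] with its
    polynomials. *)
Lemma spoly_intertwine A C D p : rowfin A -> rowfin C -> rowfin D ->
  A *oo C = D *oo A -> A *oo spoly p C = spoly p D *oo A.
Proof.
move=> fA fC fD AC; apply: smx_ext => n m.
rewrite smul_spolyr // smul_spolyl //; apply: eq_bigr => i _; congr (_ * _).
suff -> : A *oo spow C i = spow D i *oo A by [].
elim: (i : nat) => [|k IH]; first by rewrite smulr1_rowfin // smul1r.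
rewrite /spow /= -!/(spow _ _) smulA // AC -!smulA // ?IH //.
exact: rowfin_spow.
Qed.

Lemma spolyX A : rowfin A -> spoly 'X A = A.
Proof.
move=> fA; apply: smx_ext => n m; rewrite /spoly size_polyX.
rewrite !big_ord_recr big_ord0 !coefX /= mul0r add0r mul1r add0r.
by rewrite /spow /= smulr1_rowfin.
Qed.

Lemma slower_smul A C : slower A -> slower C -> slower (A *oo C).
Proof.
move=> lA lC n m nm; rewrite (smul_lowerE _ _ lA (ltnSn n)) big1 // => k _.
by rewrite lC ?mulr0 // (leq_ltn_trans _ nm) // -ltnS.
Qed.

Lemma smul_slower_diag A C n : slower A -> slower C ->
  (A *oo C) n n = A n n * C n n.
Proof.
move=> lA lC; rewrite (smul_lowerE _ _ lA (ltnSn n)) big_ord_recr /=.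
by rewrite big1 ?add0r // => k _; rewrite lC ?mulr0.
Qed.

Lemma scomm_mulr A C D : rowfin A -> rowfin C -> rowfin D ->
  A *oo D = D *oo A -> scomm A (C *oo D) = scomm A C *oo D.
Proof.
move=> fA fC fD AD; rewrite -[scomm A C]/(ssub (A *oo C) (C *oo A)).
rewrite smulBl; try exact: rowfin_smul.
by rewrite -(@smulA C A) // AD (@smulA C D) // -(@smulA A C).
Qed.

Lemma scomm_mull A C D : rowfin A -> rowfin C -> rowfin D ->
  A *oo D = D *oo A -> scomm (C *oo D) A = scomm C A *oo D.
Proof.
move=> fA fC fD AD; rewrite -[scomm C A]/(ssub (C *oo A) (A *oo C)).
rewrite smulBl; try exact: rowfin_smul.
by rewrite -(@smulA C A) // AD (@smulA C D) // -(@smulA A C).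
Qed.

Lemma shift_smulE A n m : (shift *oo A) n m = A n.+1 m.
Proof.
rewrite (@smulE n.+2); last by move=> k nk; rewrite /Defs.shift gtn_eqF.
rewrite big_ord_recr /= [shift _ n.+1]/Defs.shift eqxx mul1r.
by rewrite big1 ?add0r // => k _; rewrite /Defs.shift ltn_eqF ?mul0r.
Qed.

Lemma scomm_shift_pascal : scomm shift pascal = pascal :> smx K.
Proof.
apply: smx_ext => n m; rewrite /scomm shift_smulE.
rewrite (smul_lowerE _ _ slower_pascal (ltnSn n)) /Defs.shift.
case: m => [|m].
  by rewrite big1 ?subr0 /pascal ?bin0 // => k _; rewrite mulr0.
(* Column [m.+1] of [shift] has its only nonzero entry in row [m]; above the diagonal of [pascal]
   all binomials vanish. *)
have [mn|nm] := ltnP m n.+1; last first.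
  rewrite big1 ?subr0; last first.
    by move=> k _; rewrite eqSS gtn_eqF ?mulr0 // (leq_trans _ nm).
  by rewrite /pascal binS !bin_small // (leq_trans nm).
rewrite (bigD1 (Ordinal mn)) //= eqxx mulr1 big1 ?addr0 => [|k km].
  by rewrite /pascal binS natrD addrK.
by rewrite eqSS eq_sym -val_eqE /= in km *; rewrite (negPf km) mulr0.
Qed.

(** Each left factor [shift] replaces a row by the next one. *)
Lemma spoly_shiftE p A n m :
  (spoly p shift *oo A) n m = \sum_(i < size p) p`_i * A (n + i)%N m.
Proof.
rewrite smul_spolyl; last exact: rowfin_shift.
apply: eq_bigr => i _; congr (_ * _).
elim: (i : nat) n => [|j IH] n; first by rewrite smul1r addn0.
rewrite /spow /= -/(spow _ _) -smulA; [|exact: rowfin_shift|]; last first.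
  by apply: rowfin_spow; exact: rowfin_shift.
by rewrite shift_smulE IH addSnnS.
Qed.

End RowFinite.

(** * The moment functional of the weight and the Pearson equation *)

Section MomentFunctional.
Context {K : numFieldType}.
Variable w : nat -> K.
Hypothesis w_cvg : moments_cvg w.
Implicit Types p q : {poly K}.

Definition pterms p : nat -> K := fun k => p.[k%:R] * w k.

Definition mom p : K := limn (series (pterms p)).

Lemma ptermsD p q : pterms (p + q) = pterms p + pterms q.
Proof. by apply/funext => k; rewrite /pterms hornerD mulrDl. Qed.

Lemma ptermsZ a p : pterms (a *: p) = a *: pterms p.
Proof. by apply/funext => k; rewrite /pterms hornerZ -mulrA. Qed.

Lemma ptermsXn n : pterms 'X^n = moment_terms w n.
Proof. by apply/funext => k; rewrite /pterms hornerXn. Qed.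

Lemma pterms0 : pterms 0 = 0.
Proof. by apply/funext => k; rewrite /pterms horner0 mul0r. Qed.

Lemma series_pterms0 : series (pterms 0) = cst 0.
Proof. by apply/funext => n; rewrite pterms0 /series /= big1. Qed.

Lemma pterms_cvg p : cvgn (series (pterms p)).
Proof.
rewrite -[p]coefK poly_def.
elim/big_ind: _ => [|p1 p2 c1 c2|i _].
- by rewrite series_pterms0; exact: is_cvg_cst.
- by rewrite ptermsD; exact: is_cvg_seriesD.
- by rewrite ptermsZ ptermsXn; apply: is_cvg_seriesZ; apply: w_cvg.
Qed.

Lemma mom0 : mom 0 = 0.
Proof.
by rewrite /mom series_pterms0; apply: lim_cst; exact: norm_hausdorff.
Qed.

Lemma momD p q : mom (p + q) = mom p + mom q.
Proof. by rewrite /mom ptermsD lim_seriesD //; exact: pterms_cvg. Qed.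

Lemma momZ a p : mom (a *: p) = a * mom p.
Proof. by rewrite /mom ptermsZ lim_seriesZ //; exact: pterms_cvg. Qed.

Lemma mom_sum n (F : 'I_n -> {poly K}) : mom (\sum_i F i) = \sum_i mom (F i).
Proof. exact: (big_morph mom momD mom0). Qed.

Lemma momXn n : mom 'X^n = moment w n.
Proof. by rewrite /mom ptermsXn. Qed.

(** Summation index shift: the term at 0 vanishes with [theta.[0]], and the Pearson equation
    rewrites the term at [k.+1]. *)
Lemma mom_pearson theta sigma q : theta.[0] = 0 -> pearson w theta sigma ->
  mom (theta * q) = mom (sigma * (q \Po ('X + 1))).
Proof.
move=> theta0 pw; rewrite /mom; set u := series _; set v := series _.
(* The extra first term is zero, so the partial sums agree up to one index, which leaves the limit
   unchanged. *)
suff uv : [sequence u n.+1]_n = v.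
  have cv : (v @ \oo --> limn v)%classic by exact: pterms_cvg.
  by apply: cvg_lim; [exact: norm_hausdorff | rewrite -cvg_shiftS uv].
apply/funext => n; rewrite /u /v /= /series /= big_nat_recl //.
rewrite {1}/pterms hornerM theta0 !mul0r add0r; apply: eq_bigr => k _.
rewrite /pterms !hornerM horner_comp hornerD hornerX hornerC natr1.
by rewrite mulrAC pw mulrAC.
Qed.

(** On the Hankel matrix of moments, [shift] acts as multiplication by the variable. *)
Lemma spoly_shift_moment p n m :
  (spoly p shift *oo moment_mx w) n m = mom (p * 'X^(n + m)).
Proof.
rewrite spoly_shiftE -[in RHS](coefK p) poly_def mulr_suml mom_sum.
apply: eq_bigr => i _; rewrite -scalerAl momZ -exprD momXn /moment_mx.
by rewrite addnAC addnC.
Qed.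

Lemma pascal_polyXn n :
  \sum_(k < n.+1) (pascal : smx K) n k *: 'X^k = ('X + 1) ^+ n :> {poly K}.
Proof.
rewrite addrC exprDn; apply: eq_bigr => k _.
by rewrite expr1n mul1r scaler_nat.
Qed.

(** By the binomial theorem, [pascal] on the left turns ['X^n] into [('X + 1) ^+ n], and its
    transpose on the right does the same for ['X^m]. *)
Lemma pascal_moment p n m :
  (pascal *oo (spoly p shift *oo moment_mx w) *oo str pascal) n m =
  mom (p * ('X + 1) ^+ (n + m)).
Proof.
rewrite -[LHS]/(str (_ *oo str pascal) m n) str_smul.
rewrite (smul_lowerE _ _ (@slower_pascal K) (ltnSn m)) exprD mulrA.
rewrite -[in RHS](pascal_polyXn m) mulr_sumr mom_sum; apply: eq_bigr => j _.
rewrite -scalerAr momZ; congr (_ * _).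
rewrite /str (smul_lowerE _ _ (@slower_pascal K) (ltnSn n)).
rewrite -pascal_polyXn mulr_sumr mulr_suml mom_sum; apply: eq_bigr => i _.
by rewrite spoly_shift_moment -scalerAr -scalerAl momZ exprD mulrA.
Qed.

Lemma pearson_moment theta sigma : theta.[0] = 0 -> pearson w theta sigma ->
  spoly theta shift *oo moment_mx w =
  pascal *oo (spoly sigma shift *oo moment_mx w) *oo str pascal.
Proof.
move=> theta0 pw; apply: smx_ext => n m.
rewrite spoly_shift_moment pascal_moment (mom_pearson _ theta0 pw).
by rewrite comp_Xn_poly.
Qed.

Lemma str_spoly_shift_moment p :
  str (spoly p shift *oo moment_mx w) = spoly p shift *oo moment_mx w.
Proof. by apply: smx_ext => n m; rewrite /str !spoly_shift_moment addnC. Qed.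

End MomentFunctional.

(** * Dressing the moment identities and Pascal's rule by [S] *)

Theorem proposition8 (K : numFieldType) (w : nat -> K)
    (theta sigma : {poly K}) (S : smx K) (h : nat -> K)
    (hcvg : moments_cvg w)
    (hminors : leading_minors_neq0 (moment_mx w))
    (hchol : cholesky (moment_mx w) S h)
    (htheta0 : theta.[0] = 0)
    (hpearson : pearson w theta sigma) :
  let H := sdiag h in
  let J := jacobi S in
  let Pi := dressed_pascal S in
  let Psi := slinv Pi *oo H *oo spoly theta (str J) in
  [/\ Psi = spoly sigma J *oo H *oo str Pi,
      scomm (Psi *oo slinv H) J = Psi *oo slinv H
    & scomm J (str Psi *oo slinv H) = str Psi *oo slinv H].
Proof.
move=> H J Pi Psi; case: hchol => [[lS dS] h_neq0 hG].
set G := moment_mx w in hG; set T := slinv S in hG.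
have [lT ST TS] : [/\ slower T, S *oo T = sone & T *oo S = sone].
  by apply: slinvP => // n; rewrite dS oner_neq0.
have fS := rowfin_slower lS; have fT := rowfin_slower lT.
have fH : rowfin H := @rowfin_sdiag K h.
have fL := @rowfin_shift K; have lB := @slower_pascal K.
have fB := rowfin_slower lB.
have fJ : rowfin J by do ?apply: rowfin_smul.
have lPi : slower Pi by do ?apply: slower_smul.
have fPi := rowfin_slower lPi.
have fsJ p := rowfin_spoly p fJ; have fsL p := rowfin_spoly p fL.
have JS : J *oo S = S *oo shift.
  rewrite /J /jacobi -smulA ?TS ?smulr1_rowfin //; exact: rowfin_smul.
have PiS : Pi *oo S = S *oo pascal.
  rewrite /Pi /dressed_pascal -smulA ?TS ?smulr1_rowfin //; exact: rowfin_smul.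
have SsL p : S *oo spoly p shift = spoly p J *oo S by exact: spoly_intertwine.
have dT n : T n n = 1.
  by rewrite -[LHS]mul1r -{1}(dS n) -smul_slower_diag // ST soneE eqxx.
have dPi n : Pi n n = 1.
  rewrite /Pi /dressed_pascal !smul_slower_diag //; last exact: slower_smul.
  by rewrite dS -/T dT /pascal binn !mulr1.
have [lQ PQ QP] : [/\ slower (slinv Pi), Pi *oo slinv Pi = sone
    & slinv Pi *oo Pi = sone].
  by apply: slinvP => // n; rewrite dPi oner_neq0.
have fQ := rowfin_slower lQ.
have [fHi HHi HiH] : [/\ rowfin (slinv H), H *oo slinv H = sone
    & slinv H *oo H = sone].
  have [||lHi ? ?] := @slinvP K H; first exact: slower_sdiag.
    by move=> n; rewrite /H /sdiag eqxx.
  by split=> //; exact: rowfin_slower.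
have TW : str T *oo str S = sone by rewrite -str_smul ST str_sdiag.
have HGW : S *oo G *oo str S = H.
  rewrite hG smulA ?smulA //; last exact: rowfin_smul.
  by rewrite ST smul1r -smulA_col // TW smulr1_rowfin.
have spolyJH p : spoly p J *oo H = S *oo (spoly p shift *oo G) *oo str S.
  rewrite -{1}HGW (@smulA_col _ (spoly p J)) // (@smulA _ (spoly p J)) //.
  by rewrite -SsL -(@smulA _ S).
have str_spolyJH p : str (spoly p J *oo H) = spoly p J *oo H.
  rewrite spolyJH str_smul (str_smul S) str_spoly_shift_moment //.
  exact: smulA_col.
(* This is the symmetry of [spoly p J *oo H] at [p = 'X]. *)
have HJt : H *oo str J = J *oo H.
  by rewrite -[J in RHS]spolyX // -str_spolyJH str_smul str_sdiag spolyX.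
(* The finiteness of the columns of [J] comes from the conjugation of [str J] to [J] by [H], without
   computing the tridiagonal entries. *)
have fJt : rowfin (str J).
  have -> : str J = slinv H *oo (J *oo H).
    by rewrite -HJt smulA // HiH smul1r.
  by do ?apply: rowfin_smul.
have HsJt p : H *oo spoly p (str J) = spoly p J *oo H.
  exact: spoly_intertwine.
have PsiE : Psi = slinv Pi *oo spoly theta J *oo H.
  by rewrite /Psi -smulA // HsJt smulA.
have WPi : str S *oo str Pi = str pascal *oo str S.
  by rewrite -(str_smul Pi) PiS str_smul.
have thetaH : spoly theta J *oo H = Pi *oo (spoly sigma J *oo H) *oo str Pi.
  rewrite !spolyJH (pearson_moment hcvg htheta0 hpearson).
  set M := spoly sigma shift *oo _.
  (* The factors left of [M] are row-finite and those right of it column-finite, so the regrouping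
     is valid around [M]. *)
  rewrite (@smulA_col _ Pi) // (@smulA _ Pi S) // PiS.
  rewrite -(@smulA_cols _ _ (str S)) // WPi (@smulA_cols _ _ (str pascal)) //.
  by rewrite (@smulA_col _ S (pascal *oo M)) // (@smulA _ S).
have Psi2 : Psi = spoly sigma J *oo H *oo str Pi.
  rewrite PsiE -smulA // thetaH smulA_col // smulA // QP.
  by rewrite smul1r.
have JPi : scomm J Pi = Pi.
  have -> : scomm J Pi = S *oo scomm shift pascal *oo T.
    rewrite -[RHS]/(S *oo ssub (shift *oo pascal) (pascal *oo shift) *oo T).
    rewrite smulBr // smulBl; try by do ?apply: rowfin_smul.
    rewrite -[LHS]/(ssub (J *oo Pi) (Pi *oo J)); congr ssub.
      rewrite {1}/Pi /dressed_pascal !smulA // ?JS //; exact: rowfin_smul.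
    rewrite {1}/J /jacobi !smulA // ?PiS //; exact: rowfin_smul.
  by rewrite scomm_shift_pascal.
(* Multiply [JPi] by [slinv Pi] on both sides and cancel. *)
have QJ : scomm (slinv Pi) J = slinv Pi.
  rewrite -[RHS]smulr1_rowfin // -PQ smulA // -{3}JPi.
  rewrite -[scomm J Pi]/(ssub (J *oo Pi) (Pi *oo J)).
  rewrite smulBr // smulBl; try by do ?apply: rowfin_smul.
  rewrite -[LHS]/(ssub (slinv Pi *oo J) (J *oo slinv Pi)); congr ssub.
    rewrite smulA // -smulA ?PQ ?smulr1_rowfin //; exact: rowfin_smul.
  by rewrite smulA // QP smul1r.
have Jcomm p : J *oo spoly p J = spoly p J *oo J by exact: spoly_intertwine.
split=> //.
- have -> : Psi *oo slinv H = slinv Pi *oo spoly theta J.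
    have fQtheta : rowfin (slinv Pi *oo spoly theta J) by exact: rowfin_smul.
    by rewrite PsiE -(@smulA _ _ H) // HHi smulr1_rowfin.
  by rewrite scomm_mull // QJ.
(* Transposing the second expression of [Psi] leaves the symmetric factor [spoly sigma J *oo H]
   intact. *)
have -> : str Psi *oo slinv H = Pi *oo spoly sigma J.
  rewrite Psi2 str_smul str_spolyJH -[str (str Pi)]/Pi -(@smulA _ Pi) //.
    by rewrite -(@smulA _ _ H) // HHi smulr1_rowfin.
  exact: rowfin_smul.
by rewrite scomm_mulr // JPi.
Qed.
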